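(* For every integer $m>6C^2(C+1)$, $$R_m=\begin{cases} m-2 & \text{if } m\not\equiv 2 \pmod 3,\\ m-3 & \text{if } m\equiv 2\pmod 3.\end{cases}$$
   Context: For an integer $m\ge 3$ and $x\in\mathbb Z$ put $P_m(x)=\frac{m-2}{2}x^2-\frac{m-4}{2}x$ (generalized $m$-gonal numbers). An $m$-gonal form of rank $n$ is $F_m(\mathbf x)=a_1P_m(x_1)+\cdots+a_nP_m(x_n)$ with positive integers $a_1\le a_2\le\cdots\le a_n$ and integer variables $x_i\in\mathbb Z$. It represents $N\in\mathbb N$ if $F_m(\mathbf x)=N$ has a solution $\mathbf x\in\mathbb Z^n$; it is universal if it represents every positive integer. The truant of a non-universal form is the smallest positive integer it does not represent (the empty form of rank $0$ represents nothing, so its truant is $1$). The escalator tree of $m$-gonal forms is the rooted tree whose root is the empty form; a node $\sum_{i=1}^k a_iP_m(x_i)$ that is universal is a leaf, and a non-universal node has as children exactly all forms $\sum_{i=1}^{k+1}a_iP_m(x_i)$ with $a_{k+1}\ge a_k$ (any $a_1\ge1$ if $k=0$) that represent the truant of the node. $r_m$ denotes the minimal rank of a leaf of this tree and $R_m$ the maximal rank of a leaf. Standing assumption: $C$ is a fixed absolute constant such that for every $m\ge3$, every $m$-gonal form that represents every positive integer in $[1,C(m-2)]$ is universal. *)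

(* Defs.v *)
From Stdlib Require Import Reals Arith ZArith List Sorted Lia Lra.
Import ListNotations.

(* Generalized m-gonal number P_m(x) = ((m-2)x^2 - (m-4)x)/2 (always an integer). *)
Definition Pm (m : nat) (x : Z) : Z :=
  (((Z.of_nat m - 2) * x * x - (Z.of_nat m - 4) * x) / 2)%Z.

Fixpoint form_value (m : nat) (a : list nat) (x : list Z) : Z :=
  match a, x with
  | a1 :: a', x1 :: x' => (Z.of_nat a1 * Pm m x1 + form_value m a' x')%Z
  | _, _ => 0%Z
  end.

Definition represents (m : nat) (a : list nat) (N : nat) : Prop :=
  exists x : list Z, length x = length a /\ form_value m a x = Z.of_nat N.

Definition universal (m : nat) (a : list nat) : Prop :=
  forall N : nat, 1 <= N -> represents m a N.

Definition valid_form (a : list nat) : Prop :=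
  Forall (fun c => 1 <= c) a /\ Sorted le a.

Definition truant (m : nat) (a : list nat) (t : nat) : Prop :=
  1 <= t /\ ~ represents m a t /\ (forall k, 1 <= k < t -> represents m a k).

(* Nodes of the escalator tree of m-gonal forms.  A child of a non-universal
   node a (with truant t) appends a coefficient c >= last coefficient
   (c >= 1 at the root) such that the new form represents t. *)
Inductive escalator_node (m : nat) : list nat -> Prop :=
| esc_root : escalator_node m []
| esc_child : forall (a : list nat) (t c : nat),
    escalator_node m a -> truant m a t -> last a 1 <= c ->
    represents m (a ++ [c]) t -> escalator_node m (a ++ [c]).

Definition escalator_leaf (m : nat) (a : list nat) : Prop :=
  escalator_node m a /\ universal m a.

Definition standing_assumption (C : R) : Prop :=
  forall m : nat, 3 <= m -> forall a : list nat, valid_form a ->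
    (forall N : nat, 1 <= N -> (INR N <= C * (INR m - 2))%R -> represents m a N) ->
    universal m a.

(* Main.v *)
Require Import Defs.
From Stdlib Require Import Reals Arith ZArith List.
From Stdlib Require Import Sorted Permutation Lia Lra Classical.
Import ListNotations.

(** Write P_m(x) = (m-2) T(x) + x with T(x) = x(x-1)/2, so that a form takes the values
(m-2) A + B with A = sum a_i T(x_i) and B = sum a_i x_i.  The truant of a node exceeds the
sum of its coefficients (adding c to a node of truant t covers c + [0, t-1] too), and the
constant C bounds it by C(m-2).  Hence a non-universal node b of rank at least m-3 contains
some small coefficient q many times; take the least one.  Moving j coordinates of q from
{0, 1} to {-1, 2} adds jq(m-3) to a value, so the truant is less than q(m-3) and the
coefficients of b sum to less than that.

Let P be the coefficients below q.  If for some 0 < A < q the values B of P (or of an initial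
part of P) at level A meet all residues modulo q, then the copies of q and a greedy choice of
the remaining coefficients produce the truant at this level, because the sum of the
coefficients is close to qm: a contradiction.  This works for every q >= 2, by a finite
computation, except for P = (1), q = 2 and for P = (1,1) or (1,2), q = 3; in these cases the
sum of the coefficients alone bounds the rank, up to a few explicit representations when
m = 2 mod 3.  The exceptional forms 1,1,3,...,3 and 1,2,3,...,3 attain the bound; the first
also gives C >= 3, which makes m large enough for all estimates. *)

(** * Forms in terms of A and B *)

Definition tri (x : Z) : Z := (x * (x - 1) / 2)%Z.

Lemma double_tri (x : Z) : (2 * tri x = x * (x - 1))%Z.
Proof.
  unfold tri.
  assert (H : (x * (x - 1) mod 2 = 0)%Z).
  { rewrite Z.mul_mod, Zminus_mod by lia.
    destruct (Z.mod_pos_bound x 2 ltac:(lia)) as [H0 H1].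
    assert (E : (x mod 2 = 0 \/ x mod 2 = 1)%Z) by lia.
    destruct E as [-> | ->]; reflexivity. }
  pose proof (Z.div_mod (x * (x - 1)) 2); lia.
Qed.

Lemma Pm_tri (m : nat) (x : Z) : (Pm m x = (Z.of_nat m - 2) * tri x + x)%Z.
Proof.
  unfold Pm.
  replace ((Z.of_nat m - 2) * x * x - (Z.of_nat m - 4) * x)%Z
    with (((Z.of_nat m - 2) * tri x + x) * 2)%Z
    by (pose proof (double_tri x); nia).
  apply Z.div_mul; lia.
Qed.

Lemma tri_lower (x : Z) : (0 <= tri x /\ - tri x <= x <= 1 + tri x)%Z.
Proof. pose proof (double_tri x); nia. Qed.

Lemma Pm_0 (m : nat) : Pm m 0 = 0%Z.
Proof. rewrite Pm_tri; change (tri 0) with 0%Z; lia. Qed.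

Lemma Pm_1 (m : nat) : Pm m 1 = 1%Z.
Proof. rewrite Pm_tri; change (tri 1) with 0%Z; lia. Qed.

Lemma Pm_m1 (m : nat) : Pm m (-1) = (Z.of_nat m - 3)%Z.
Proof. rewrite Pm_tri; change (tri (-1)) with 1%Z; lia. Qed.

Lemma Pm_2 (m : nat) : Pm m 2 = Z.of_nat m.
Proof. rewrite Pm_tri; change (tri 2) with 1%Z; lia. Qed.

Lemma Pm_values (m : nat) (x : Z) : 3 <= m ->
  Pm m x = 0%Z \/ Pm m x = 1%Z \/ (Pm m x = Z.of_nat m - 3)%Z \/
  Pm m x = Z.of_nat m \/ (3 * Z.of_nat m - 8 <= Pm m x)%Z.
Proof.
  intros Hm.
  assert (Hx : (x = 0 \/ x = 1 \/ x = -1 \/ x = 2 \/ x <= -2 \/ 3 <= x)%Z) by lia.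
  destruct Hx as [-> | [-> | [-> | [-> | Hx]]]];
    rewrite ?Pm_0, ?Pm_1, ?Pm_m1, ?Pm_2; auto.
  do 4 right. rewrite Pm_tri. pose proof (double_tri x).
  assert (3 <= tri x)%Z by nia.
  assert (- 2 <= x - 3 + tri x + 1)%Z by nia.
  nia.
Qed.

Lemma Pm_zero_or_one (m : nat) (x : Z) : 4 <= m -> (Pm m x < Z.of_nat m - 3)%Z ->
  Pm m x = 0%Z \/ Pm m x = 1%Z.
Proof. intros Hm H. pose proof (Pm_values m x). lia. Qed.

Lemma Pm_nonneg (m : nat) (x : Z) : 3 <= m -> (0 <= Pm m x)%Z.
Proof. intros Hm. pose proof (Pm_values m x). lia. Qed.

Fixpoint repZ (m : nat) (a : list nat) (z : Z) : Prop :=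
  match a with
  | [] => z = 0%Z
  | c :: a' => exists x, repZ m a' (z - Z.of_nat c * Pm m x)%Z
  end.

Fixpoint repAB (a : list nat) (A B : Z) : Prop :=
  match a with
  | [] => A = 0%Z /\ B = 0%Z
  | c :: a' => exists x, repAB a' (A - Z.of_nat c * tri x) (B - Z.of_nat c * x)
  end.

Fixpoint subsum (a : list nat) (s : Z) : Prop :=
  match a with
  | [] => s = 0%Z
  | c :: a' => subsum a' s \/ subsum a' (s - Z.of_nat c)%Z
  end.

Definition zsum (a : list nat) : Z := Z.of_nat (list_sum a).

Lemma zsum_cons (c : nat) (a : list nat) : zsum (c :: a) = (Z.of_nat c + zsum a)%Z.
Proof. unfold zsum; simpl; lia. Qed.

Lemma zsum_app (a b : list nat) : zsum (a ++ b) = (zsum a + zsum b)%Z.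
Proof. unfold zsum; rewrite list_sum_app; lia. Qed.

Lemma zsum_nonneg (a : list nat) : (0 <= zsum a)%Z.
Proof. unfold zsum; lia. Qed.

Lemma zsum_repeat (q L : nat) : zsum (repeat q L) = (Z.of_nat q * Z.of_nat L)%Z.
Proof. induction L; simpl repeat; rewrite ?zsum_cons; [unfold zsum; simpl|]; lia. Qed.

Lemma represents_repZ (m : nat) (a : list nat) (N : nat) :
  represents m a N <-> repZ m a (Z.of_nat N).
Proof.
  unfold represents. generalize (Z.of_nat N) as z.
  induction a as [|c a IH]; intros z; simpl.
  - split.
    + intros (x & _ & H). auto.
    + intros ->. exists []. auto.
  - split.
    + intros ([|x xs] & Hl & H); [discriminate|].
      exists x. apply IH. exists xs. simpl in *; split; lia.
    + intros (x & H). apply IH in H. destruct H as (xs & Hl & H).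
      exists (x :: xs). simpl; split; lia.
Qed.

Lemma repZ_app (m : nat) (a b : list nat) (z w : Z) :
  repZ m a z -> repZ m b w -> repZ m (a ++ b) (z + w).
Proof.
  revert z; induction a as [|c a IH]; simpl; intros z.
  - intros ->; auto.
  - intros (x & H) Hw. exists x.
    replace (z + w - Z.of_nat c * Pm m x)%Z
      with (z - Z.of_nat c * Pm m x + w)%Z by lia. auto.
Qed.

Lemma repZ_app_inv (m : nat) (a b : list nat) (z : Z) :
  repZ m (a ++ b) z -> exists w, repZ m a w /\ repZ m b (z - w).
Proof.
  revert z; induction a as [|c a IH]; simpl; intros z.
  - intros H; exists 0%Z; split; auto. now rewrite Z.sub_0_r.
  - intros (x & H). apply IH in H. destruct H as (w & Hw & H).
    exists (w + Z.of_nat c * Pm m x)%Z; split.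
    + exists x. now replace (w + Z.of_nat c * Pm m x - Z.of_nat c * Pm m x)%Z with w by lia.
    + now replace (z - (w + Z.of_nat c * Pm m x))%Z
        with (z - Z.of_nat c * Pm m x - w)%Z by lia.
Qed.

Lemma repZ_perm (m : nat) (a b : list nat) (z : Z) :
  Permutation a b -> repZ m a z -> repZ m b z.
Proof.
  intros Hp; revert z; induction Hp; simpl; intros z; auto.
  - intros (w & H); exists w; auto.
  - intros (u & v & H); exists v, u.
    now replace (z - Z.of_nat x * Pm m v - Z.of_nat y * Pm m u)%Z
      with (z - Z.of_nat y * Pm m u - Z.of_nat x * Pm m v)%Z by lia.
Qed.

Lemma repZ_nonneg (m : nat) (a : list nat) (z : Z) : 3 <= m -> repZ m a z -> (0 <= z)%Z.
Proof.
  intros Hm; revert z; induction a as [|c a IH]; simpl; intros z.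
  - lia.
  - intros (x & H). apply IH in H. pose proof (Pm_nonneg m x Hm). nia.
Qed.

Lemma repZ_0 (m : nat) (a : list nat) : repZ m a 0.
Proof.
  induction a as [|c a IH]; simpl; auto.
  exists 0%Z. now rewrite Pm_0, Z.mul_0_r.
Qed.

Lemma repZ_small (m : nat) (a : list nat) (z : Z) : 4 <= m -> Forall (fun c => 1 <= c) a ->
  (z < Z.of_nat m - 3)%Z -> repZ m a z -> (z <= zsum a)%Z.
Proof.
  intros Hm Ha; revert z; induction Ha as [|c a Hc Ha IH]; simpl; intros z Hz.
  - unfold zsum; simpl; lia.
  - intros (x & H). rewrite zsum_cons.
    pose proof (repZ_nonneg m a _ ltac:(lia) H).
    pose proof (Pm_nonneg m x ltac:(lia)).
    assert (Hx : Pm m x = 0%Z \/ Pm m x = 1%Z) by (apply Pm_zero_or_one; nia).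
    apply IH in H; nia.
Qed.

Lemma subsum_repAB (a : list nat) (s : Z) : subsum a s -> repAB a 0 s.
Proof.
  revert s; induction a as [|c a IH]; simpl; intros s; auto.
  intros [H|H]; apply IH in H.
  - exists 0%Z. change (tri 0) with 0%Z. now rewrite !Z.mul_0_r, !Z.sub_0_r.
  - exists 1%Z. change (tri 1) with 0%Z. now rewrite Z.mul_0_r, Z.mul_1_r.
Qed.

Lemma repAB_repZ (m : nat) (a : list nat) (A B : Z) :
  repAB a A B -> repZ m a ((Z.of_nat m - 2) * A + B).
Proof.
  revert A B; induction a as [|c a IH]; simpl; intros A B.
  - lia.
  - intros (x & H). exists x. apply IH in H. rewrite Pm_tri.
    eapply eq_ind; [exact H|]. ring.
Qed.

Lemma subsum_repZ (m : nat) (a : list nat) (s : Z) : subsum a s -> repZ m a s.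
Proof.
  intros H%subsum_repAB%(repAB_repZ m).
  now replace ((Z.of_nat m - 2) * 0 + s)%Z with s in H by lia.
Qed.

Lemma repAB_app (a b : list nat) (A B A' B' : Z) :
  repAB a A B -> repAB b A' B' -> repAB (a ++ b) (A + A') (B + B').
Proof.
  revert A B; induction a as [|c a IH]; simpl; intros A B.
  - intros [-> ->]; auto.
  - intros (x & H) H'. exists x.
    specialize (IH _ _ H H').
    replace (A + A' - Z.of_nat c * tri x)%Z with (A - Z.of_nat c * tri x + A')%Z by lia.
    now replace (B + B' - Z.of_nat c * x)%Z with (B - Z.of_nat c * x + B')%Z by lia.
Qed.

Lemma repAB_bounds (a : list nat) (A B : Z) : repAB a A B -> (- A <= B <= zsum a + A)%Z.
Proof.
  revert A B; induction a as [|c a IH]; simpl; intros A B.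
  - unfold zsum; simpl; lia.
  - intros (x & H). apply IH in H. rewrite zsum_cons.
    pose proof (tri_lower x). nia.
Qed.

Lemma subsum_app (a b : list nat) (s t : Z) :
  subsum a s -> subsum b t -> subsum (a ++ b) (s + t).
Proof.
  revert s; induction a as [|c a IH]; simpl; intros s.
  - intros ->; auto.
  - intros [H|H] Ht; [left|right]; auto.
    replace (s + t - Z.of_nat c)%Z with (s - Z.of_nat c + t)%Z by lia. auto.
Qed.

Lemma subsum_app_inv (a b : list nat) (s : Z) :
  subsum (a ++ b) s -> exists u, subsum a u /\ subsum b (s - u).
Proof.
  revert s; induction a as [|c a IH]; simpl; intros s.
  - intros H; exists 0%Z; split; auto. now rewrite Z.sub_0_r.
  - intros [H|H]; apply IH in H; destruct H as (u & Hu & H).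
    + exists u; auto.
    + exists (u + Z.of_nat c)%Z; split.
      * right. now replace (u + Z.of_nat c - Z.of_nat c)%Z with u by lia.
      * now replace (s - (u + Z.of_nat c))%Z with (s - Z.of_nat c - u)%Z by lia.
Qed.

Lemma subsum_0 (a : list nat) : subsum a 0.
Proof. induction a; simpl; auto. Qed.

Lemma subsum_bounds (a : list nat) (s : Z) : subsum a s -> (0 <= s <= zsum a)%Z.
Proof.
  revert s; induction a as [|c a IH]; simpl; intros s.
  - unfold zsum; simpl; lia.
  - rewrite zsum_cons. intros [H|H]; apply IH in H; lia.
Qed.

Lemma subsum_repeat (q L u : nat) : u <= L -> subsum (repeat q L) (Z.of_nat q * Z.of_nat u).
Proof.
  revert u; induction L as [|L IH]; intros u Hu; simpl.
  - replace u with 0 by lia. lia.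
  - destruct u as [|u].
    + left. apply (IH 0). lia.
    + right. replace (Z.of_nat q * Z.of_nat (S u) - Z.of_nat q)%Z
        with (Z.of_nat q * Z.of_nat u)%Z by nia.
      apply IH. lia.
Qed.

Lemma subsum_complete (a : list nat) :
  (forall pre c post, a = pre ++ c :: post -> c <= list_sum pre + 1) ->
  forall s, (0 <= s <= zsum a)%Z -> subsum a s.
Proof.
  induction a as [|c a IH] using rev_ind; intros Hc s Hs.
  - unfold zsum in Hs; simpl in *; lia.
  - rewrite zsum_app, zsum_cons in Hs. unfold zsum in Hs at 2; simpl in Hs.
    assert (Hca : c <= list_sum a + 1) by (apply (Hc a c []); auto).
    assert (IH' : forall s, (0 <= s <= zsum a)%Z -> subsum a s).
    { apply IH. intros pre d post ->. apply (Hc pre d (post ++ [c])).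
      now rewrite <- app_assoc. }
    destruct (Z_le_gt_dec s (zsum a)).
    + replace s with (s + 0)%Z by lia. apply subsum_app; [apply IH'; lia | simpl; auto].
    + replace s with ((s - Z.of_nat c) + Z.of_nat c)%Z by lia.
      apply subsum_app; [apply IH'; unfold zsum in *; lia | simpl; right; lia].
Qed.

Lemma repZ_repeat (m q L a b c : nat) : a + b + c <= L ->
  repZ m (repeat q L)
    (Z.of_nat q * (Z.of_nat a * (Z.of_nat m - 3) + Z.of_nat b * Z.of_nat m + Z.of_nat c)).
Proof.
  intros H. replace L with (a + (b + (c + (L - a - b - c)))) by lia.
  rewrite !repeat_app.
  assert (R : forall k x, repZ m (repeat q k) (Z.of_nat q * (Z.of_nat k * Pm m x))).
  { induction k as [|k IH]; intros x; simpl repeat.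
    - simpl; lia.
    - exists x. eapply eq_ind; [apply (IH x)|]. nia. }
  eapply eq_ind.
  - apply repZ_app; [apply (R a (-1)%Z)|].
    apply repZ_app; [apply (R b 2%Z)|].
    apply repZ_app; [apply (R c 1%Z)|]. apply (R _ 0%Z).
  - rewrite Pm_0, Pm_1, Pm_2, Pm_m1. ring.
Qed.

Lemma repZ_repeat_small (m q L : nat) (z : Z) : 4 <= m -> 1 <= q ->
  (z < Z.of_nat q * (Z.of_nat m - 3))%Z -> repZ m (repeat q L) z ->
  exists u, u <= L /\ z = (Z.of_nat q * Z.of_nat u)%Z.
Proof.
  intros Hm Hq. revert z; induction L as [|L IH]; simpl; intros z Hz.
  - intros ->. exists 0; lia.
  - intros (x & H).
    pose proof (repZ_nonneg m _ _ ltac:(lia) H).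
    pose proof (Pm_nonneg m x ltac:(lia)).
    assert (Hx : Pm m x = 0%Z \/ Pm m x = 1%Z) by (apply Pm_zero_or_one; nia).
    apply IH in H; [|nia]. destruct H as (u & Hu & H).
    destruct Hx as [E|E]; rewrite E in H; [exists u | exists (S u)]; lia.
Qed.

(* Turning j zeros among the coordinates of [q] into -1 adds j(m-3) q.  When zeros are
   scarce, some ones become 2 instead, which adds m-1, and this is compensated by turning two
   further ones into zeros. *)
Lemma repZ_lift (m q L j : nat) (b rest : list nat) (z : Z) :
  4 <= m -> 1 <= q -> j + 2 <= L -> Permutation (repeat q L ++ rest) b ->
  (z < Z.of_nat q * (Z.of_nat m - 3))%Z -> repZ m b z ->
  repZ m b (z + Z.of_nat j * (Z.of_nat q * (Z.of_nat m - 3))).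
Proof.
  intros Hm Hq HL Hp Hz H.
  eapply repZ_perm; [exact Hp|]. apply (repZ_perm m b _ z (Permutation_sym Hp)) in H.
  apply repZ_app_inv in H. destruct H as (w & Hw & H).
  pose proof (repZ_nonneg m _ _ ltac:(lia) H).
  apply repZ_repeat_small in Hw; [|lia..]. destruct Hw as (u & Hu & ->).
  replace (z + Z.of_nat j * (Z.of_nat q * (Z.of_nat m - 3)))%Z
    with (Z.of_nat q * (Z.of_nat j * (Z.of_nat m - 3) + Z.of_nat u)
          + (z - Z.of_nat q * Z.of_nat u))%Z by lia.
  apply repZ_app; auto.
  assert (E : exists b, b <= j /\ 3 * b <= u /\ j + (u - 3 * b) <= L).
  { destruct (le_gt_dec (u + j) L).
    - exists 0; lia.
    - destruct j as [|j]; [lia|].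
      exists ((u + S j - L + 2) / 3).
      pose proof (Nat.div_mod_eq (u + S j - L + 2) 3).
      pose proof (Nat.mod_upper_bound (u + S j - L + 2) 3). lia. }
  destruct E as (d & Hd & Hdu & HdL).
  eapply eq_ind; [apply (repZ_repeat m q L (j - d) d (u - 3 * d)); lia|].
  f_equal. nia.
Qed.

(** * Nodes of the escalator tree *)

Lemma truant_exists (m : nat) (a : list nat) : ~ universal m a -> exists t, truant m a t.
Proof.
  intros H.
  assert (E : exists N, 1 <= N /\ ~ represents m a N).
  { apply NNPP; intros E. apply H. intros N HN. apply NNPP; intros E'. eauto. }
  destruct E as (N & HN). revert HN.
  induction N as [N IH] using lt_wf_ind. intros (HN1 & HN).
  destruct (classic (exists k, k < N /\ 1 <= k /\ ~ represents m a k)) as [(k & Hk & H')|E].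
  - exact (IH k Hk H').
  - exists N. repeat split; auto. intros k Hk. apply NNPP; intros Hr.
    apply E. exists k. repeat split; auto; lia.
Qed.

Lemma truant_not_universal (m : nat) (a : list nat) (t : nat) : truant m a t -> ~ universal m a.
Proof. intros (H1 & H2 & _) H. auto. Qed.

Lemma truant_repZ (m : nat) (a : list nat) (t : nat) (z : Z) :
  truant m a t -> (0 <= z < Z.of_nat t)%Z -> repZ m a z.
Proof.
  intros (_ & _ & H) Hz. destruct (Z.eq_dec z 0) as [->|].
  - apply repZ_0.
  - rewrite <- (Z2Nat.id z) by lia. apply represents_repZ, H. lia.
Qed.

Lemma truant_not_repZ (m : nat) (a : list nat) (t : nat) : truant m a t -> ~ repZ m a (Z.of_nat t).
Proof. intros (_ & H & _). now rewrite represents_repZ in H. Qed.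

Lemma child_le_truant (m : nat) (a : list nat) (t c : nat) : 4 <= m -> truant m a t ->
  represents m (a ++ [c]) t -> c <= t.
Proof.
  intros Hm Ht H. apply represents_repZ, repZ_app_inv in H.
  destruct H as (w & Hw & x & H). simpl in H.
  pose proof (repZ_nonneg m a w ltac:(lia) Hw).
  destruct (Z.eq_dec (Pm m x) 0) as [E|E].
  - exfalso. apply (truant_not_repZ m a t Ht). rewrite E in H.
    now replace (Z.of_nat t) with w by lia.
  - pose proof (Pm_nonneg m x ltac:(lia)). nia.
Qed.

Lemma repZ_snoc (m : nat) (a : list nat) (c : nat) (z : Z) : repZ m a z -> repZ m (a ++ [c]) z.
Proof.
  intros H. rewrite <- (Z.add_0_r z). apply repZ_app; auto. apply repZ_0.
Qed.

Lemma repZ_snoc_add (m : nat) (a : list nat) (c : nat) (z : Z) :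
  repZ m a (z - Z.of_nat c) -> repZ m (a ++ [c]) z.
Proof.
  intros H. replace z with (z - Z.of_nat c + Z.of_nat c)%Z by lia.
  apply repZ_app; auto. exists 1%Z. rewrite Pm_1. simpl; lia.
Qed.

Lemma node_child (m : nat) (a : list nat) (t c : nat) : escalator_node m a -> truant m a t ->
  last a 1 <= c <= t -> escalator_node m (a ++ [c]).
Proof.
  intros Ha Ht Hc. apply (esc_child m a t c); auto; [tauto|].
  apply represents_repZ, repZ_snoc_add, (truant_repZ m a t); auto.
  assert (1 <= c); [|lia].
  enough (1 <= last a 1) by lia.
  clear -Ha. induction Ha as [|a t c Ha IH Ht Hc Hr].
  - simpl; lia.
  - rewrite last_last. lia.
Qed.

Lemma node_sum_lt_truant (m : nat) (a : list nat) : 4 <= m -> escalator_node m a ->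
  forall z, (0 <= z <= zsum a)%Z -> repZ m a z.
Proof.
  intros Hm Ha. induction Ha as [|a t c Ha IH Ht Hc Hr]; intros z Hz.
  - unfold zsum in Hz; simpl in *; lia.
  - pose proof (child_le_truant m a t c Hm Ht Hr).
    rewrite zsum_app, zsum_cons in Hz. unfold zsum in Hz at 2; simpl in Hz.
    destruct (Z_lt_le_dec z (Z.of_nat t)).
    + apply repZ_snoc, (truant_repZ m a t); auto; lia.
    + apply repZ_snoc_add, IH. lia.
Qed.

Lemma truant_gt_sum (m : nat) (a : list nat) (t : nat) : 4 <= m -> escalator_node m a ->
  truant m a t -> (zsum a < Z.of_nat t)%Z.
Proof.
  intros Hm Ha Ht. destruct (Z_lt_le_dec (zsum a) (Z.of_nat t)); auto. exfalso.
  apply (truant_not_repZ m a t Ht), node_sum_lt_truant; auto; lia.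
Qed.

Lemma StronglySorted_snoc (a : list nat) (c : nat) : StronglySorted le a ->
  Forall (fun x => x <= c) a -> StronglySorted le (a ++ [c]).
Proof.
  induction 1 as [|x a Ha IH Hx]; intros Hc; simpl.
  - repeat constructor.
  - inversion Hc; subst. constructor; auto. apply Forall_app; auto.
Qed.

Lemma last_ge (a : list nat) : StronglySorted le a -> Forall (fun x => x <= last a 1) a.
Proof.
  induction a as [|c a IH] using rev_ind; intros Hs; auto.
  rewrite last_last. clear IH.
  induction a as [|x a IH]; simpl in *.
  - auto.
  - inversion Hs as [|? ? Hs' Hx]; subst. constructor; auto.
    apply Forall_app in Hx. destruct Hx as (_ & Hx). now inversion Hx.
Qed.

Lemma node_sorted (m : nat) (a : list nat) : escalator_node m a ->
  StronglySorted le a /\ Forall (fun c => 1 <= c) a.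
Proof.
  induction 1 as [|a t c Ha [IH1 IH2] Ht Hc Hr].
  - repeat constructor.
  - split.
    + apply StronglySorted_snoc; auto.
      eapply Forall_impl; [|apply last_ge; auto]. simpl; lia.
    + apply Forall_app; split; auto. constructor; auto.
      destruct a as [|x a] using rev_ind; [simpl in Hc; lia|].
      rewrite last_last in Hc. apply Forall_app in IH2. destruct IH2 as (_ & H).
      inversion H; lia.
Qed.

Lemma node_valid (m : nat) (a : list nat) : escalator_node m a -> valid_form a.
Proof.
  intros H%node_sorted. split; [tauto|]. now apply StronglySorted_Sorted.
Qed.

Lemma snoc_decomposition (a pre post : list nat) (c d : nat) : a ++ [c] = pre ++ d :: post ->
  (pre = a /\ d = c /\ post = []) \/ exists post', a = pre ++ d :: post'.
Proof.
  destruct post as [|e post] using rev_ind; intros H.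
  - apply app_inj_tail in H. left. intuition congruence.
  - right. exists post. rewrite app_comm_cons, app_assoc in H.
    apply app_inj_tail in H. tauto.
Qed.

Lemma node_prefix (m : nat) (a : list nat) : 4 <= m -> escalator_node m a ->
  forall pre c post, a = pre ++ c :: post ->
  escalator_node m pre /\ exists t, truant m pre t /\ c <= t.
Proof.
  intros Hm. induction 1 as [|a t c Ha IH Ht Hc Hr]; intros pre d post E.
  - destruct pre; discriminate.
  - apply snoc_decomposition in E. destruct E as [(-> & -> & ->)|(post' & E)].
    + split; auto. exists t; split; auto. eapply child_le_truant; eauto.
    + eauto.
Qed.

Lemma node_step_bound (m : nat) (a pre post : list nat) (c : nat) : 4 <= m ->
  escalator_node m a -> a = pre ++ c :: post -> list_sum pre + 4 < m ->
  c <= list_sum pre + 1.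
Proof.
  intros Hm Ha E Hs.
  destruct (node_prefix m a Hm Ha pre c post E) as (Hp & t & Ht & Hc).
  destruct (le_gt_dec t (list_sum pre + 1)); [lia|]. exfalso.
  assert (H : repZ m pre (Z.of_nat (list_sum pre + 1))) by (apply (truant_repZ m pre t); auto; lia).
  apply repZ_small in H; [unfold zsum in H; lia|lia|apply (node_sorted m pre Hp)|lia].
Qed.

(** * Residue classes reached at a fixed level *)

Local Open Scope Z_scope.

(* tri takes the value k on {0,1}, {-1,2}, {-2,3}, {-3,4}, {-4,5} for k = 0, 1, 3, 6, 10. *)
Fixpoint Vset (a : list nat) (A : Z) : list Z :=
  match a with
  | [] => if A =? 0 then [0] else []
  | c :: a' =>
    let c := Z.of_nat c in
    flat_map (fun kxy => let '(k, x, y) := kxy in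
      if A - c * k <? 0 then [] else
      let l := Vset a' (A - c * k) in
      map (fun b => b + c * x) l ++ map (fun b => b + c * y) l)
     [(0, 0, 1); (1, -1, 2); (3, -2, 3); (6, -3, 4); (10, -4, 5)]
  end.

Definition residues_full (q : Z) (l : list Z) : bool :=
  forallb (fun r => existsb (fun b => b mod q =? Z.of_nat r) l) (seq 0 (Z.to_nat q)).

Definition has_full (q : nat) (a : list nat) : bool :=
  existsb (fun A => residues_full (Z.of_nat q) (Vset a (Z.of_nat A))) (seq 1 (q - 1)).

Fixpoint full_tree (fuel q : nat) (a : list nat) : bool :=
  if has_full q a then true else
  if (q - 1 <=? list_sum a)%nat then false else
  match fuel with
  | O => false
  | S f => forallb (fun c => full_tree f q (a ++ [c]))
             (seq (last a 1%nat) (Nat.min (list_sum a + 1) (q - 1) + 1 - last a 1%nat))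
  end.
Definition has_block (a : list nat) : bool :=
  existsb (fun A => let l := Vset a (Z.of_nat A) in
    existsb (fun c => forallb (fun i => existsb (Z.eqb (Z.of_nat c - 10 + Z.of_nat i)) l)
      (seq 0 (list_sum a + 1))) (seq 0 20))
   (seq 1 12).

Definition full (q : nat) (a : list nat) : Prop :=
  exists A, 1 <= A <= Z.of_nat q - 1 /\
    forall r, exists B k, repAB a A B /\ B = r + Z.of_nat q * k.

Lemma Vset_sound (a : list nat) (A B : Z) : In B (Vset a A) -> repAB a A B.
Proof.
  revert A B; induction a as [|c a IH]; intros A B H.
  - simpl in *. destruct (Z.eqb_spec A 0); simpl in H; intuition lia.
  - cbn [Vset] in H. apply in_flat_map in H.
    destruct H as ([[k x] y] & Hk & H).
    destruct (A - Z.of_nat c * k <? 0); [destruct H|].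
    assert (E : tri x = k /\ tri y = k).
    { simpl in Hk. intuition (inversion_clear H0 || inversion_clear H1; split; reflexivity). }
    destruct E as [Ex Ey].
    apply in_app_iff in H. rewrite !in_map_iff in H. simpl.
    destruct H as [(b & <- & H)|(b & <- & H)]; apply IH in H; [exists x | exists y].
    + rewrite Ex. now replace (b + Z.of_nat c * x - Z.of_nat c * x) with b by lia.
    + rewrite Ey. now replace (b + Z.of_nat c * y - Z.of_nat c * y) with b by lia.
Qed.

Lemma full_app (q : nat) (a b : list nat) : full q a -> full q (a ++ b).
Proof.
  intros (A & HA & H). exists A; split; auto. intros r.
  destruct (H r) as (B & k & HB & E). exists B, k; split; auto.
  rewrite <- (Z.add_0_r A), <- (Z.add_0_r B). apply repAB_app; auto.
  apply subsum_repAB, subsum_0.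
Qed.

Lemma has_full_sound (q : nat) (a : list nat) : has_full q a = true -> full q a.
Proof.
  intros H. apply existsb_exists in H. destruct H as (A & HA & H).
  apply in_seq in HA. exists (Z.of_nat A). split; [lia|]. intros r.
  unfold residues_full in H. rewrite forallb_forall in H.
  pose proof (Z.mod_pos_bound r (Z.of_nat q) ltac:(lia)) as Hr.
  specialize (H (Z.to_nat (r mod Z.of_nat q))).
  rewrite in_seq in H. specialize (H ltac:(lia)).
  apply existsb_exists in H. destruct H as (B & HB & E).
  apply Z.eqb_eq in E. rewrite Z2Nat.id in E by lia.
  exists B, (B / Z.of_nat q - r / Z.of_nat q). split; [now apply Vset_sound|].
  pose proof (Z.div_mod B (Z.of_nat q) ltac:(lia)).
  pose proof (Z.div_mod r (Z.of_nat q) ltac:(lia)). lia.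
Qed.

Definition complete (a : list nat) : Prop :=
  forall pre c post, a = pre ++ c :: post -> (c <= list_sum pre + 1)%nat.

(* If the first coefficients reach a translate of their full range of subset sums,
   then so does the whole list, and such a block meets every residue class. *)
Lemma has_block_sound (q : nat) (a b : list nat) : (13 <= q)%nat -> has_block a = true ->
  complete (a ++ b) -> (q - 1 <= list_sum (a ++ b))%nat -> full q (a ++ b).
Proof.
  intros Hq H Hc Hs. unfold has_block in H. apply existsb_exists in H.
  destruct H as (A & HA & H). apply in_seq in HA.
  apply existsb_exists in H. destruct H as (c & _ & H).
  rewrite forallb_forall in H.
  exists (Z.of_nat A). split; [lia|]. intros r.
  set (d := Z.of_nat c - 10) in *.
  pose proof (Z.mod_pos_bound (r - d) (Z.of_nat q) ltac:(lia)) as Hr.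
  pose proof (Z.div_mod (r - d) (Z.of_nat q) ltac:(lia)) as Hd.
  set (s := (r - d) mod Z.of_nat q) in *.
  assert (Hsub : subsum (a ++ b) s) by (apply subsum_complete; auto; unfold zsum; lia).
  apply subsum_app_inv in Hsub. destruct Hsub as (u & Hu & Hv).
  pose proof (subsum_bounds a u Hu) as Hb. unfold zsum in Hb.
  specialize (H (Z.to_nat u)). rewrite in_seq in H. specialize (H ltac:(lia)).
  apply existsb_exists in H. destruct H as (B & HB & E). apply Z.eqb_eq in E.
  rewrite Z2Nat.id in E by lia.
  exists (B + (s - u)), (- ((r - d) / Z.of_nat q)). split; [|lia].
  rewrite <- (Z.add_0_r (Z.of_nat A)). apply repAB_app; [now apply Vset_sound|].
  now apply subsum_repAB.
Qed.

Lemma StronglySorted_last (a b : list nat) (c : nat) : StronglySorted le (a ++ c :: b) ->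
  (1 <= c -> last a 1 <= c)%nat.
Proof.
  destruct a as [|x a _] using rev_ind; simpl; auto.
  rewrite last_last, <- app_assoc. intros H _.
  induction a as [|y a IH]; simpl in H; inversion H; subst; auto.
  inversion H3; auto.
Qed.

Lemma full_tree_sound (fuel q : nat) (a b : list nat) : full_tree fuel q a = true ->
  StronglySorted le (a ++ b) -> Forall (fun c => 1 <= c < q)%nat (a ++ b) ->
  complete (a ++ b) -> (q - 1 <= list_sum (a ++ b))%nat -> full q (a ++ b).
Proof.
  revert a b; induction fuel as [|fuel IH]; intros a b H Hso Hf Hc Hs; simpl in H;
    destruct (has_full q a) eqn:E; try (apply full_app, has_full_sound; assumption);
    destruct (Nat.leb_spec (q - 1) (list_sum a)); try discriminate.
  destruct b as [|c b]; [rewrite app_nil_r in Hs; lia|].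
  assert (E' : (a ++ c :: b) = (a ++ [c]) ++ b) by now rewrite <- app_assoc.
  rewrite forallb_forall in H. rewrite E' in *. apply IH; auto.
  apply H, in_seq. rewrite <- E' in *.
  assert (Hcq : (1 <= c < q)%nat) by (apply Forall_app in Hf; destruct Hf as (_ & Hf); now inversion Hf).
  pose proof (StronglySorted_last a b c Hso).
  pose proof (Hc a c b eq_refl). lia.
Qed.

Lemma full_of_complete (q : nat) (a : list nat) : (4 <= q)%nat ->
  StronglySorted le a -> Forall (fun c => 1 <= c < q)%nat a ->
  complete a -> (q - 1 <= list_sum a)%nat -> full q a.
Proof.
  intros Hq Hso Hf Hc Hs.
  destruct (le_lt_dec q 12) as [Hq'|Hq'].
  - apply (full_tree_sound 12 q [] a); auto.
    assert (T : forallb (fun q => full_tree 12 q []) (seq 4 9) = true) by (vm_compute; reflexivity).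
    rewrite forallb_forall in T. apply T, in_seq. lia.
  - destruct a as [|x [|y [|z a]]]; simpl in Hs; try lia.
    + pose proof (Hc [] x [] eq_refl); simpl in *; lia.
    + pose proof (Hc [] x [y] eq_refl). pose proof (Hc [x] y [] eq_refl). simpl in *; lia.
    + pose proof (Hc [] x (y :: z :: a) eq_refl) as Hx.
      pose proof (Hc [x] y (z :: a) eq_refl) as Hy.
      pose proof (Hc [x; y] z a eq_refl) as Hz. simpl in Hx, Hy, Hz.
      apply Forall_inv in Hf as Hf1.
      pose proof (StronglySorted_last [x] (z :: a) y Hso) as Sy.
      pose proof (StronglySorted_last [x; y] a z Hso) as Sz. simpl in Sy, Sz.
      assert (Hf3 : (1 <= y /\ 1 <= z)%nat).
      { inversion Hf as [|? ? _ Hf2]; subst. inversion Hf2 as [|? ? ? Hf3]; subst.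
        inversion Hf3; subst. lia. }
      assert (E : (x = 1 /\ (y = 1 /\ (z = 1 \/ z = 2 \/ z = 3) \/ y = 2 /\ (z = 2 \/ z = 3 \/ z = 4)))%nat) by lia.
      change (x :: y :: z :: a) with ([x; y; z] ++ a).
      apply has_block_sound; auto.
      destruct E as (-> & [(-> & [->|[->| ->]])|(-> & [->|[->| ->]])]); vm_compute; reflexivity.
Qed.

Lemma minimal_prefix (k : nat) (a : list nat) : (k <= list_sum a)%nat ->
  exists p r, a = p ++ r /\ (k <= list_sum p)%nat /\
    forall pre c post, p = pre ++ c :: post -> (list_sum pre < k)%nat.
Proof.
  induction a as [|c a IH] using rev_ind; intros Hk.
  - exists [], []. repeat split; auto. intros [|? ?]; discriminate.
  - destruct (le_lt_dec k (list_sum a)) as [H|H].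
    + destruct (IH H) as (p & r & -> & Hp). exists p, (r ++ [c]).
      rewrite app_assoc. auto.
    + exists (a ++ [c]), []. rewrite app_nil_r. repeat split; auto.
      intros pre d post E. destruct post as [|e post _] using rev_ind.
      * apply app_inj_tail in E. destruct E as (-> & _). auto.
      * rewrite app_comm_cons, app_assoc in E. apply app_inj_tail in E.
        destruct E as (-> & _). rewrite list_sum_app in H. lia.
Qed.

Lemma full_or_exceptional (q : nat) (a : list nat) : (2 <= q)%nat ->
  StronglySorted le a -> Forall (fun c => 1 <= c < q)%nat a ->
  (forall pre c post, a = pre ++ c :: post -> (list_sum pre < q)%nat ->
     (c <= list_sum pre + 1)%nat) ->
  (q - 1 <= list_sum a)%nat ->
  (exists p r, a = p ++ r /\ (list_sum p <= 2 * q)%nat /\ full q p) \/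
  (q = 2 /\ a = [1])%nat \/ (q = 3 /\ (a = [1; 1] \/ a = [1; 2]))%nat.
Proof.
  intros Hq Hso Hf Hc Hs.
  destruct (le_lt_dec q 3) as [Hq'|Hq'].
  - assert (F : forall p r, a = p ++ r -> (list_sum p <= 2 * q)%nat -> has_full q p = true ->
      exists p r, a = p ++ r /\ (list_sum p <= 2 * q)%nat /\ full q p)
      by (intros p r; exists p, r; auto using has_full_sound).
    assert (E : (q = 2 \/ q = 3)%nat) by lia.
    destruct a as [|x a]; [simpl in Hs; lia|].
    inversion Hf as [|? ? Hx Hf1]; subst.
    pose proof (Hc [] x a eq_refl) as Cx. simpl in Cx.
    assert (x = 1%nat) by lia; subst x.
    destruct a as [|y a].
    { simpl in Hs. destruct E; [auto|lia]. }
    inversion Hf1 as [|? ? Hy Hf2]; subst.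
    destruct E as [-> | ->].
    + assert (y = 1%nat) by lia; subst y.
      left. apply (F [1; 1]%nat a); [auto | simpl; lia | vm_compute; reflexivity].
    + destruct a as [|z a].
      { right; right. split; auto. assert (y = 1 \/ y = 2)%nat as [-> | ->] by lia; auto. }
      inversion Hf2 as [|? ? Hz Hf3]; subst.
      pose proof (StronglySorted_last [1; y]%nat a z Hso) as Sz. simpl in Sz.
      left. apply (F [1%nat; y; z] a); [auto | simpl; lia|].
      assert (E : (y = 1 /\ z = 1 \/ y = 1 /\ z = 2 \/ y = 2 /\ z = 2)%nat) by lia.
      destruct E as [(-> & ->)|[(-> & ->)|(-> & ->)]]; vm_compute; reflexivity.
  - left. destruct (minimal_prefix (q - 1) a Hs) as (p & r & -> & Hp & Hmin).
    assert (Hcp : complete p).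
    { intros pre c post E. apply (Hc pre c (post ++ r)).
      - rewrite E, <- app_assoc. reflexivity.
      - pose proof (Hmin pre c post E). lia. }
    apply Forall_app in Hf. destruct Hf as (Hf & _).
    exists p, r. repeat split; auto.
    + destruct p as [|c p _] using rev_ind; [simpl; lia|].
      pose proof (Hmin p c [] eq_refl). rewrite list_sum_app; simpl.
      apply Forall_app in Hf. destruct Hf as (_ & Hf). apply Forall_inv in Hf. lia.
    + apply full_of_complete; auto; try lia.
      clear -Hso. induction p as [|x p IH]; simpl in *; [constructor|].
      inversion Hso; subst. constructor; auto. apply Forall_app in H2. tauto.
Qed.

Local Close Scope Z_scope.

(** * Greedy representation of the truant *)

Lemma StronglySorted_split (q : nat) (b : list nat) : StronglySorted le b ->
  exists P R, b = P ++ repeat q (count_occ Nat.eq_dec b q) ++ R /\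
    Forall (fun c => c < q) P /\ Forall (fun c => q < c) R.
Proof.
  induction 1 as [|x b Hb (P & R & E & HP & HR) Hx].
  - exists [], []. auto.
  - simpl. destruct (lt_eq_lt_dec x q) as [[H|H]|H].
    + destruct (Nat.eq_dec x q); [lia|].
      exists (x :: P), R. simpl. rewrite <- E. auto.
    + subst x. destruct (Nat.eq_dec q q); [|lia].
      destruct P as [|p P].
      * exists [], R. simpl in *. rewrite <- E. auto.
      * rewrite E in Hx. apply Forall_inv in Hx. apply Forall_inv in HP. lia.
    + destruct (Nat.eq_dec x q); [lia|].
      assert (Hall : Forall (fun c => q < c) b) by (eapply Forall_impl; [|exact Hx]; simpl; lia).
      exists [], (x :: b).
      assert (count_occ Nat.eq_dec b q = 0) as ->.
      { apply count_occ_not_In. intros Hin. rewrite Forall_forall in Hall.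
        specialize (Hall q Hin). lia. }
      simpl. auto.
Qed.

Definition deficit (q : nat) (l : list nat) : nat := list_sum (map (fun a => q - a) l).

Lemma deficit_app (q : nat) (k l : list nat) : deficit q (k ++ l) = deficit q k + deficit q l.
Proof. unfold deficit. now rewrite map_app, list_sum_app. Qed.

Lemma sum_deficit (q : nat) (l : list nat) : q * length l <= list_sum l + deficit q l.
Proof. unfold deficit. induction l; simpl; lia. Qed.

Lemma count_small (q M : nat) (l : list nat) : Forall (fun c => 1 <= c) l ->
  (forall v, 1 <= v <= q -> count_occ Nat.eq_dec l v <= M) ->
  length (filter (fun a => a <=? q) l) <= q * M.
Proof.
  intros Hl. induction q as [|q IH]; intros H.
  - simpl. clear H. induction Hl as [|c l Hc Hl IH]; simpl; auto.
    destruct (Nat.leb_spec c 0); simpl; lia.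
  - assert (E : length (filter (fun a => a <=? S q) l) =
      length (filter (fun a => a <=? q) l) + count_occ Nat.eq_dec l (S q)).
    { clear. induction l as [|c l IH]; cbn [filter count_occ length]; auto.
      destruct (Nat.leb_spec c (S q)), (Nat.leb_spec c q), (Nat.eq_dec c (S q));
        cbn [length]; lia. }
    rewrite E. specialize (H (S q) ltac:(lia)) as H'.
    assert (length (filter (fun a => a <=? q) l) <= q * M) by (apply IH; intros; apply H; lia).
    lia.
Qed.

Lemma deficit_bound (q M : nat) (l : list nat) : Forall (fun c => 1 <= c) l ->
  (forall v, 1 <= v < q -> count_occ Nat.eq_dec l v <= M) ->
  2 * deficit q l <= M * (q * (q - 1)).
Proof.
  intros Hl. induction q as [|q IH]; intros H.
  - unfold deficit. clear. induction l; simpl in *; lia.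
  - assert (E : deficit (S q) l = deficit q l + length (filter (fun a => a <=? q) l)).
    { unfold deficit. clear. induction l as [|c l IH]; cbn [map filter]; auto.
      destruct (Nat.leb_spec c q); cbn [list_sum fold_right length] in *;
        unfold list_sum in *; cbn [fold_right length] in *; lia. }
    rewrite E. pose proof (count_small q M l Hl ltac:(intros; apply H; lia)).
    assert (2 * deficit q l <= M * (q * (q - 1))) by (apply IH; intros; apply H; lia).
    destruct q; simpl in *; nia.
Qed.

Lemma greedy (O : list nat) (lo hi : Z) : exists O1 O2, O = O1 ++ O2 /\
  (forall y, (lo <= y <= hi + zsum O1)%Z -> exists w, subsum O1 w /\ (lo <= y - w <= hi)%Z) /\
  (forall h O', O2 = h :: O' -> (hi + zsum O1 - lo + 1 < Z.of_nat h)%Z).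
Proof.
  revert hi. induction O as [|o O IH]; intros hi.
  - exists [], []. repeat split; [|discriminate].
    unfold zsum; simpl. intros y Hy. exists 0%Z. lia.
  - destruct (Z_le_gt_dec (Z.of_nat o) (hi - lo + 1)) as [Ho|Ho].
    + destruct (IH (hi + Z.of_nat o)%Z) as (O1 & O2 & -> & H1 & H2).
      exists (o :: O1), O2. rewrite zsum_cons. repeat split.
      * intros y Hy. destruct (H1 y ltac:(lia)) as (w & Hw & Hyw).
        destruct (Z_le_gt_dec (y - w) hi).
        -- exists w. simpl. split; auto; lia.
        -- exists (w + Z.of_nat o)%Z. simpl. split; [|lia].
           right. now replace (w + Z.of_nat o - Z.of_nat o)%Z with w by lia.
      * intros h O' E. specialize (H2 h O' E). lia.
    + exists [], (o :: O). repeat split.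
      * unfold zsum; simpl. intros y Hy. exists 0%Z. lia.
      * intros h O' [= -> ->]. unfold zsum; simpl. lia.
Qed.

Lemma StronglySorted_app_r (a b : list nat) : StronglySorted le (a ++ b) -> StronglySorted le b.
Proof. induction a; simpl; auto. intros H. inversion H; auto. Qed.

Lemma zsum_ge_length (h : nat) (l : list nat) : Forall (fun c => h <= c) l ->
  (Z.of_nat (length l) * Z.of_nat h <= zsum l)%Z.
Proof.
  induction 1 as [|c l Hc Hl IH]; [unfold zsum; simpl; lia|].
  rewrite zsum_cons. cbn [length]. lia.
Qed.

Lemma full_represents (m q L : nat) (P O1 : list nat) : 1 <= q -> full q P ->
  list_sum P <= 2 * q ->
  (forall y, (3 * Z.of_nat q <= y <= Z.of_nat q * Z.of_nat L - Z.of_nat q + zsum O1)%Z ->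
     exists w, subsum O1 w /\
       (3 * Z.of_nat q <= y - w <= Z.of_nat q * Z.of_nat L - Z.of_nat q)%Z) ->
  forall t, (forall A, (1 <= A <= Z.of_nat q - 1)%Z -> (3 * Z.of_nat q <= t - (Z.of_nat m - 2) * A
     <= Z.of_nat q * Z.of_nat L - Z.of_nat q + zsum O1)%Z) ->
  repZ m (P ++ repeat q L ++ O1) t.
Proof.
  intros Hq (A & HA & HF) HP HO t Ht.
  destruct (HO _ (Ht A HA)) as (w & Hw & Hyw).
  destruct (HF (t - (Z.of_nat m - 2) * A - w)%Z) as (B & k & HB & E).
  pose proof (repAB_bounds P A B HB) as HBb. unfold zsum in HBb.
  assert (Hk : (0 <= - k <= Z.of_nat L)%Z) by nia.
  replace t with (((Z.of_nat m - 2) * A + B) + (Z.of_nat q * Z.of_nat (Z.to_nat (- k)) + w))%Z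
    by (rewrite Z2Nat.id by lia; lia).
  apply repZ_app; [now apply repAB_repZ|].
  apply repZ_app; [|now apply subsum_repZ].
  apply subsum_repZ, subsum_repeat. lia.
Qed.

Local Open Scope Z_scope.
Lemma tail_short (k M n x Q H s2 : Z) :
  3 <= k -> 3 * (k * k * k) + 20 <= M -> 2 <= Q <= k -> M - 3 <= n -> 1 <= x ->
  4 * k * Q <= H -> x * (H - 4 * Q) <= s2 -> H + s2 <= k * (M - 2) ->
  Q * (n - x) <= H + 2 * Q + 2 * k * (Q * (Q - 1)) -> x <= k.
Proof.
  intros Hk HM HQ Hn Hx HH Hs2 Htot HD.
  assert (Hx3 : x * (H - 4 * Q) <= k * (M - 2)) by lia.
  assert (Hx5 : 5 * x <= M - 2).
  { assert (5 * k <= H - 4 * Q) by (clear -Hk HQ HH; nia).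
    assert (x * (5 * k) <= k * (M - 2)) by (clear -H0 Hx3 Hx; nia).
    apply (Z.mul_le_mono_pos_l _ _ k); lia. }
  assert (HkQ : 2 * k * (Q - 1) <= 2 * k * (k - 1)) by (clear -Hk HQ; nia).
  assert (Hkk : 20 * (k * (k - 1)) + 76 <= 3 * M) by (clear -Hk HM; nia).
  assert (Hbig : M - 2 <= H - 4 * Q).
  { set (z := M - 9 - x - 2 * k * (Q - 1)).
    assert (H1 : Q * z <= H - 4 * Q).
    { assert (Q * (M - 3 - x) <= Q * (n - x)) by (clear -Hn HQ; nia). unfold z; lia. }
    assert (H2 : M - 2 <= 2 * z) by (unfold z; lia).
    clear -H1 H2 HQ HM Hk. assert (0 <= k * k * k) by nia. nia. }
  assert (H1 : x * (M - 2) <= k * (M - 2)) by (clear -Hx3 Hbig Hx; nia).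
  apply (Z.mul_le_mono_pos_r _ _ (M - 2)); lia.
Qed.

Lemma target_range (k M n x Q H A t sb : Z) :
  3 <= k -> 3 * (k * k * k) + 20 <= M -> 2 <= Q <= k -> M - 3 <= n -> 0 <= x <= k ->
  Q * (n - x) <= H + 2 * Q + 2 * k * (Q * (Q - 1)) ->
  Q * n <= sb + 2 * k * (Q * (Q - 1)) -> sb < t < Q * (M - 3) -> 1 <= A <= Q - 1 ->
  3 * Q <= t - (M - 2) * A <= H - Q.
Proof.
  intros Hk HM HQ Hn Hx HD Hb Ht HA.
  assert (HdQ : 2 * k * (Q * (Q - 1)) <= 2 * k * (k * (k - 1))).
  { apply Z.mul_le_mono_nonneg_l; [lia|]. clear -HQ; nia. }
  assert (HQn : Q * (M - 3) <= Q * n) by (clear -HQ Hn; nia).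
  assert (HQx : Q * x <= k * k) by (clear -HQ Hx; nia).
  assert (HA1 : (M - 2) * A <= (M - 2) * (Q - 1)).
  { apply Z.mul_le_mono_nonneg_l; nia. }
  assert (HA2 : (M - 2) * 1 <= (M - 2) * A).
  { apply Z.mul_le_mono_nonneg_l; nia. }
  assert (2 * k * (k * (k - 1)) + k * k + 4 * k <= 3 * (k * k * k) + 18) by (clear -Hk; nia).
  split; [lia|]. idtac. lia.
Qed.

Local Close Scope Z_scope.

Lemma full_length (m K q L : nat) (P1 P2 R b : list nat) (t : nat) :
  3 <= K -> 3 * (K * K * K) + 20 <= m -> 2 <= q <= K -> 4 * K <= L ->
  b = (P1 ++ P2) ++ repeat q L ++ R -> StronglySorted le b ->
  Forall (fun c => c < q) P2 -> Forall (fun c => q < c) R ->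
  full q P1 -> list_sum P1 <= 2 * q -> deficit q b <= 2 * K * (q * (q - 1)) ->
  list_sum b < t -> t <= K * (m - 2) -> t < q * (m - 3) -> ~ repZ m b (Z.of_nat t) ->
  length b + 4 <= m.
Proof.
  intros HK Hm Hq HL Eb Hso HP2 HR HF HP1 Hdef Hbt HtK Htq Hnot.
  destruct (le_lt_dec (length b + 4) m) as [|Hn]; auto. exfalso. apply Hnot.
  destruct (greedy (P2 ++ R) (3 * Z.of_nat q) (Z.of_nat q * Z.of_nat L - Z.of_nat q))
    as (O1 & O2 & EO & HO1 & HO2).
  assert (Hperm : Permutation ((P1 ++ repeat q L ++ O1) ++ O2) b).
  { rewrite Eb, <- !app_assoc. apply Permutation_app_head.
    rewrite <- EO, !app_assoc. apply Permutation_app_tail, Permutation_app_comm. }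
  apply (repZ_perm m _ b _ Hperm).
  rewrite <- (Z.add_0_r (Z.of_nat t)). apply repZ_app; [|apply repZ_0].
  apply full_represents; auto; try lia.
  assert (Hsum : (zsum P1 + Z.of_nat q * Z.of_nat L + zsum O1 + zsum O2 = zsum b)%Z).
  { unfold zsum. rewrite <- (Permutation_list_sum Hperm), !list_sum_app.
    pose proof (zsum_repeat q L) as E. unfold zsum in E. lia. }
  assert (Hlen : length b = length (P1 ++ repeat q L ++ O1) + length O2).
  { rewrite <- (Permutation_length Hperm). apply length_app. }
  apply Nat2Z.inj_le in Hdef. rewrite !Nat2Z.inj_mul, Nat2Z.inj_sub in Hdef by lia.
  change (Z.of_nat 2) with 2%Z in Hdef. change (Z.of_nat 1) with 1%Z in Hdef.
  assert (HD : (Z.of_nat q * (Z.of_nat (length b) - Z.of_nat (length O2))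
     <= zsum P1 + Z.of_nat q * Z.of_nat L + zsum O1 + 2 * Z.of_nat K * (Z.of_nat q * (Z.of_nat q - 1)))%Z).
  { pose proof (sum_deficit q (P1 ++ repeat q L ++ O1)) as H1.
    assert (H2 : deficit q (P1 ++ repeat q L ++ O1) <= deficit q b).
    { assert (E : deficit q ((P1 ++ repeat q L ++ O1) ++ O2) = deficit q b)
        by (apply Permutation_list_sum, Permutation_map, Hperm).
      rewrite deficit_app in E. lia. }
    apply Nat2Z.inj_le in H1. rewrite Nat2Z.inj_mul, Nat2Z.inj_add in H1.
    fold (zsum (P1 ++ repeat q L ++ O1)) in H1. rewrite !zsum_app, zsum_repeat in H1.
    rewrite Hlen, Nat2Z.inj_add, Z.add_simpl_r. lia. }
  assert (Hb : (Z.of_nat q * Z.of_nat (length b)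
     <= zsum b + 2 * Z.of_nat K * (Z.of_nat q * (Z.of_nat q - 1)))%Z).
  { pose proof (sum_deficit q b) as H1. apply Nat2Z.inj_le in H1.
    rewrite Nat2Z.inj_mul, Nat2Z.inj_add in H1. unfold zsum. lia. }
  set (H := (Z.of_nat q * Z.of_nat L + zsum O1)%Z) in *.
  assert (HP1' : (zsum P1 <= 2 * Z.of_nat q)%Z) by (unfold zsum; lia).
  pose proof (zsum_nonneg P1). pose proof (zsum_nonneg O1).
  assert (HH : (4 * Z.of_nat K * Z.of_nat q <= H)%Z) by (unfold H; clear -HL H1; nia).
  assert (HO2' : O2 = [] \/ ((1 <= length O2)%nat /\
     Z.of_nat (length O2) * (H - 4 * Z.of_nat q) <= zsum O2)%Z).
  { destruct O2 as [|h O2]; auto. right. split; [simpl; lia|].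
    specialize (HO2 h O2 eq_refl).
    assert (Hs : StronglySorted le (h :: O2)).
    { apply (StronglySorted_app_r O1). rewrite <- EO.
      assert (Hs1 : StronglySorted le P2 /\ StronglySorted le R).
      { rewrite Eb in Hso. split.
        - rewrite <- app_assoc in Hso. apply StronglySorted_app_r in Hso.
          clear -Hso. induction P2 as [|x l IH]; simpl in *; [constructor|].
          inversion Hso; subst. constructor; auto. apply Forall_app in H2. tauto.
        - now do 2 apply StronglySorted_app_r in Hso. }
      destruct Hs1 as (Hs1 & Hs2). clear -Hs1 Hs2 HP2 HR.
      induction Hs1 as [|x l Hl IH Hx]; simpl; auto. inversion HP2; subst.
      constructor; auto. apply Forall_app; split; auto.
      eapply Forall_impl; [|exact HR]; simpl; lia. }
    assert (Hall : Forall (fun c => h <= c) (h :: O2)).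
    { inversion Hs; subst. constructor; auto. }
    apply zsum_ge_length in Hall. unfold H.
    eapply Z.le_trans; [|exact Hall]. apply Z.mul_le_mono_nonneg_l; lia. }
  assert (Htot : (H + zsum O2 <= Z.of_nat K * (Z.of_nat m - 2))%Z).
  { apply Nat2Z.inj_le in HtK. rewrite Nat2Z.inj_mul, Nat2Z.inj_sub in HtK by lia.
    unfold H. unfold zsum in *. lia. }
  assert (Hmz : (3 * (Z.of_nat K * Z.of_nat K * Z.of_nat K) + 20 <= Z.of_nat m)%Z) by lia.
  assert (Htz : (zsum b < Z.of_nat t < Z.of_nat q * (Z.of_nat m - 3))%Z).
  { apply Nat2Z.inj_lt in Htq. rewrite Nat2Z.inj_mul, Nat2Z.inj_sub in Htq by lia.
    unfold zsum. lia. }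
  assert (Hnz : (Z.of_nat m - 3 <= Z.of_nat (length b))%Z) by lia.
  assert (Hqz : (2 <= Z.of_nat q <= Z.of_nat K)%Z) by lia.
  assert (HKz : (3 <= Z.of_nat K)%Z) by lia.
  set (x := Z.of_nat (length O2)) in *.
  set (Q := Z.of_nat q) in *. set (k := Z.of_nat K) in *. set (M := Z.of_nat m) in *.
  set (n := Z.of_nat (length b)) in *.
  assert (Hx : (0 <= x <= k)%Z).
  { destruct HO2' as [E|(Hx1 & Hx2)]; [unfold x; rewrite E; simpl; lia|].
    split; [lia|].
    apply (tail_short k M n x Q H (zsum O2)); auto; lia. }
  intros A HA.
  assert (G : (3 * Q <= Z.of_nat t - (M - 2) * A <= H - Q)%Z)
    by (apply (target_range k M n x Q H A (Z.of_nat t) (zsum b)); auto; lia).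
  fold Q M. unfold H in G. lia.
Qed.

(** * The maximal rank *)

Lemma sum_ge (c : nat) (l : list nat) : Forall (fun d => c <= d) l -> c * length l <= list_sum l.
Proof. induction 1; simpl; lia. Qed.

Lemma exists_frequent (m K : nat) (b : list nat) : 3 <= K -> 3 * (K * K * K) + 20 <= m ->
  Forall (fun c => 1 <= c) b -> m <= length b + 3 -> list_sum b < K * (m - 2) ->
  exists q, 1 <= q <= K /\ 4 * K <= count_occ Nat.eq_dec b q /\
    forall v, 1 <= v < q -> count_occ Nat.eq_dec b v <= 4 * K.
Proof.
  intros HK Hm Hb Hn Hs.
  assert (H : forall n, (forall v, 1 <= v < n -> count_occ Nat.eq_dec b v <= 4 * K) \/
    exists q, 1 <= q < n /\ 4 * K <= count_occ Nat.eq_dec b q /\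
      forall v, 1 <= v < q -> count_occ Nat.eq_dec b v <= 4 * K).
  { induction n as [|n [IH|(q & Hq & IH)]].
    - left; lia.
    - destruct (le_lt_dec (count_occ Nat.eq_dec b n) (4 * K)) as [H|H].
      + left. intros v Hv. destruct (Nat.eq_dec v n) as [->|]; auto. apply IH; lia.
      + destruct n; [left; lia|]. right. exists (S n). repeat split; auto; lia.
    - right. exists q. split; auto; lia. }
  destruct (H (S K)) as [H1|(q & Hq & H1)]; [exfalso|exists q; split; auto; lia].
  pose proof (deficit_bound (S K) (4 * K) b Hb H1) as H2.
  pose proof (sum_deficit (S K) b) as H3.
  replace (S K - 1) with K in H2 by lia.
  assert (H4 : S K * (m - 3) <= S K * length b) by (apply Nat.mul_le_mono_l; lia).
  assert (H5 : 2 * deficit (S K) b <= 4 * (K * K * K) + 4 * (K * K)) by (clear -H2; nia).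
  assert (H6 : 3 * (K * K) <= K * K * K) by (clear -HK; nia).
  assert (H7 : 3 * K <= K * K) by (clear -HK; nia).
  replace (m - 2) with (S (m - 3)) in Hs by lia. lia.
Qed.

Lemma truant_lt_multiple (m K q L t : nat) (b rest : list nat) : 2 * K + 4 <= m -> 1 <= q ->
  K + 2 <= L -> Permutation (repeat q L ++ rest) b -> truant m b t -> t <= K * (m - 2) ->
  t < q * (m - 3).
Proof.
  intros Hm Hq HL Hp Ht HtK.
  destruct (le_lt_dec (q * (m - 3)) t) as [H|]; auto. exfalso.
  apply (truant_not_repZ m b t Ht).
  set (d := q * (m - 3)) in *.
  assert (Hd : d <> 0) by (unfold d; nia).
  pose proof (Nat.div_mod_eq t d) as E.
  pose proof (Nat.mod_upper_bound t d Hd) as Hr.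
  assert (Hj : t / d <= K).
  { apply Nat.lt_succ_r. apply Nat.Div0.div_lt_upper_bound.
    assert (m - 3 <= d) by (unfold d; nia). nia. }
  assert (Hdz : Z.of_nat d = (Z.of_nat q * (Z.of_nat m - 3))%Z).
  { unfold d. rewrite Nat2Z.inj_mul, Nat2Z.inj_sub by lia. reflexivity. }
  replace (Z.of_nat t)
    with (Z.of_nat (t mod d) + Z.of_nat (t / d) * (Z.of_nat q * (Z.of_nat m - 3)))%Z by (rewrite <- Hdz; lia).
  apply (repZ_lift m q L (t / d) b rest); auto; try lia.
  apply (truant_repZ m b t); auto; lia.
Qed.

Lemma repZ_pair_threes (m c d L : nat) (R : list nat) (x y k z : Z) : (0 <= k <= Z.of_nat L)%Z ->
  z = (Z.of_nat c * Pm m x + Z.of_nat d * Pm m y + 3 * k)%Z ->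
  repZ m ([c; d] ++ repeat 3 L ++ R) z.
Proof.
  intros Hk ->. apply repZ_app.
  - exists x, y. simpl. ring.
  - rewrite <- (Z.add_0_r (3 * k)). apply repZ_app; [|apply repZ_0].
    apply subsum_repZ. rewrite <- (Z2Nat.id k) by lia. apply (subsum_repeat 3). lia.
Qed.

Lemma one_one_threes_length (m L t : nat) (R : list nat) : 20 <= m ->
  Forall (fun c => 3 < c) R -> truant m ([1; 1] ++ repeat 3 L ++ R) t ->
  list_sum ([1; 1] ++ repeat 3 L ++ R) < t -> t < 3 * (m - 3) ->
  length ([1; 1] ++ repeat 3 L ++ R) + (if m mod 3 =? 2 then 4 else 3) <= m.
Proof.
  intros Hm HR Ht Hst Htm.
  apply sum_ge in HR.
  assert (E : list_sum (repeat 3 L) = 3 * L) by (pose proof (zsum_repeat 3 L); unfold zsum in *; lia).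
  rewrite !list_sum_app in Hst. rewrite !length_app, repeat_length.
  change (list_sum [1; 1]) with 2 in Hst. cbn [length].
  pose proof (Nat.div_mod_eq m 3) as Em.
  destruct (Nat.eqb_spec (m mod 3) 2) as [Hm3|]; [|lia].
  destruct (le_lt_dec (2 + (L + length R) + 4) m) as [|Hn]; auto. exfalso.
  apply (truant_not_repZ m _ t Ht).
  assert (Ht3 : t = 3 * m - 12 \/ t = 3 * m - 11 \/ t = 3 * m - 10) by lia.
  destruct Ht3 as [Et|[Et|Et]];
    [ apply (repZ_pair_threes m 1 1 L R 2 1 (2 * Z.of_nat (m / 3) - 3)); rewrite ?Pm_1, ?Pm_2
    | apply (repZ_pair_threes m 1 1 L R 2 2 (Z.of_nat (m / 3) - 3)); rewrite ?Pm_1, ?Pm_2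
    | apply (repZ_pair_threes m 1 1 L R 2 0 (2 * Z.of_nat (m / 3) - 2)); rewrite ?Pm_0, ?Pm_2 ];
    lia.
Qed.

Lemma one_two_threes_length (m L t : nat) (R : list nat) : 20 <= m ->
  Forall (fun c => 3 < c) R -> truant m ([1; 2] ++ repeat 3 L ++ R) t ->
  list_sum ([1; 2] ++ repeat 3 L ++ R) < t -> t < 3 * (m - 3) ->
  length ([1; 2] ++ repeat 3 L ++ R) + (if m mod 3 =? 2 then 4 else 3) <= m.
Proof.
  intros Hm HR Ht Hst Htm.
  apply sum_ge in HR.
  assert (E : list_sum (repeat 3 L) = 3 * L) by (pose proof (zsum_repeat 3 L); unfold zsum in *; lia).
  rewrite !list_sum_app in Hst. rewrite !length_app, repeat_length.
  change (list_sum [1; 2]) with 3 in Hst. cbn [length].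
  pose proof (Nat.div_mod_eq m 3) as Em.
  destruct (Nat.eqb_spec (m mod 3) 2) as [Hm3|]; [|lia].
  destruct (le_lt_dec (2 + (L + length R) + 4) m) as [|Hn]; auto. exfalso.
  apply (truant_not_repZ m _ t Ht).
  assert (Ht3 : t = 3 * m - 11 \/ t = 3 * m - 10) by lia.
  destruct Ht3 as [Et|Et];
    [ apply (repZ_pair_threes m 1 2 L R 2 1 (2 * Z.of_nat (m / 3) - 3)); rewrite ?Pm_1, ?Pm_2
    | apply (repZ_pair_threes m 1 2 L R 2 0 (2 * Z.of_nat (m / 3) - 2)); rewrite ?Pm_0, ?Pm_2 ];
    lia.
Qed.

Lemma nonuniversal_length (m K t : nat) (b : list nat) : 3 <= K -> 3 * (K * K * K) + 20 <= m ->
  escalator_node m b -> truant m b t -> t <= K * (m - 2) ->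
  length b + (if m mod 3 =? 2 then 4 else 3) <= m.
Proof.
  intros HK Hm Hb Ht HtK.
  destruct (le_lt_dec (length b + 4) m) as [H|Hn]; [destruct (m mod 3 =? 2); lia|].
  destruct (node_sorted m b Hb) as (Hso & Hpos).
  assert (HKm : K + 50 <= m) by nia.
  assert (Hst : list_sum b < t).
  { pose proof (truant_gt_sum m b t ltac:(lia) Hb Ht) as H. unfold zsum in H. lia. }
  destruct (exists_frequent m K b) as (q & Hq & Hcount & Hrare); auto; try lia.
  destruct (StronglySorted_split q b Hso) as (P & R & Eb & HP & HR).
  set (L := count_occ Nat.eq_dec b q) in *. clearbody L.
  assert (Htq : t < q * (m - 3)).
  { apply (truant_lt_multiple m K q L t b (P ++ R)); auto; try lia.
    - nia.
    - rewrite Eb. rewrite !app_assoc. apply Permutation_app_tail, Permutation_app_comm. }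
  assert (HPb : Forall (fun c => 1 <= c < q) P).
  { rewrite Eb in Hpos. apply Forall_app in Hpos. destruct Hpos as (Hpos & _).
    rewrite Forall_forall in *. auto. }
  destruct (Nat.eq_dec q 1) as [Hq1|Hq1].
  { exfalso. apply sum_ge in Hpos. subst q. lia. }
  destruct (full_or_exceptional q P) as [(P1 & P2 & EP & HP1 & HF)|[(Eq & EP)|(Eq & EP)]]; auto; try lia.
  - rewrite Eb in Hso. clear -Hso. induction P; simpl in *; [constructor|].
    inversion Hso; subst. constructor; auto. apply Forall_app in H2; tauto.
  - intros pre c post E Hpre.
    apply (node_step_bound m b pre (post ++ repeat q L ++ R) c); auto; [lia| |lia].
    rewrite Eb, E, <- app_assoc. reflexivity.
  - destruct (le_lt_dec m (list_sum P + 4)) as [|H]; [lia|].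
    assert (EL : repeat q L = q :: repeat q (L - 1)).
    { change (q :: repeat q (L - 1)) with (repeat q (S (L - 1))). f_equal; lia. }
    enough (q <= list_sum P + 1) by lia.
    apply (node_step_bound m b P (repeat q (L - 1) ++ R) q); auto; [lia|].
    rewrite Eb, EL. reflexivity.
  - exfalso. subst P.
    assert (Hdef : deficit q b <= 2 * K * (q * (q - 1))).
    { pose proof (deficit_bound q (4 * K) b Hpos Hrare) as H. clear -H. lia. }
    enough (length b + 4 <= m) by lia.
    apply (full_length m K q L P1 P2 R b t); auto; try lia.
    + apply Forall_app in HP. tauto.
    + now apply truant_not_repZ.
  - exfalso. subst q P.
    assert (H : Forall (fun d => 2 <= d) (repeat 2 L ++ R)).
    { apply Forall_app; split.
      - apply Forall_forall. intros d Hd. apply repeat_spec in Hd. lia.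
      - eapply Forall_impl; [|exact HR]. simpl; lia. }
    apply sum_ge in H. rewrite Eb in Hst, Hn. simpl in *. lia.
  - subst q. destruct EP; subst P; rewrite Eb in *.
    + apply (one_one_threes_length m L t R); auto; lia.
    + apply (one_two_threes_length m L t R); auto; lia.
Qed.

Lemma small_sum_not_universal (m : nat) (a : list nat) : 4 <= m -> Forall (fun c => 1 <= c) a ->
  list_sum a + 4 < m -> ~ universal m a.
Proof.
  intros Hm Ha Hs H. specialize (H (list_sum a + 1) ltac:(lia)).
  apply represents_repZ, repZ_small in H; auto; unfold zsum in *; lia.
Qed.

Lemma node_snoc (m c : nat) (a : list nat) : 4 <= m -> escalator_node m a -> ~ universal m a ->
  last a 1 <= c <= list_sum a + 1 -> escalator_node m (a ++ [c]).
Proof.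
  intros Hm Ha Hu Hc. destruct (truant_exists m a Hu) as (t & Ht).
  pose proof (truant_gt_sum m a t Hm Ha Ht) as H. unfold zsum in H.
  apply (node_child m a t c); auto; lia.
Qed.

Lemma node_one_c (m c : nat) : 7 <= m -> 1 <= c <= 2 -> escalator_node m [1; c].
Proof.
  intros Hm Hc. apply (node_snoc m c [1]); try (simpl; lia).
  - apply (node_snoc m 1 []); try (simpl; lia).
    + constructor.
    + apply small_sum_not_universal; auto; simpl; lia.
  - apply small_sum_not_universal; auto; simpl; lia.
Qed.

Lemma node_threes (m c k : nat) : 7 <= m -> 1 <= c <= 2 ->
  (forall j, j < k -> ~ universal m ([1; c] ++ repeat 3 j)) ->
  escalator_node m ([1; c] ++ repeat 3 k).
Proof.
  intros Hm Hc. induction k as [|k IH]; intros Hu.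
  - now apply node_one_c.
  - change (repeat 3 (S k)) with (3 :: repeat 3 k). rewrite repeat_cons, app_assoc.
    apply node_snoc; auto; [lia|].
    split.
    + destruct k; [simpl; lia|]. change (repeat 3 (S k)) with (3 :: repeat 3 k).
      rewrite repeat_cons, app_assoc, last_last. lia.
    + simpl. lia.
Qed.

Lemma pair_threes_inv (m c d k : nat) (z : Z) : 4 <= m -> (z < 3 * (Z.of_nat m - 3))%Z ->
  repZ m ([c; d] ++ repeat 3 k) z ->
  exists x y u, u <= k /\ z = (Z.of_nat c * Pm m x + Z.of_nat d * Pm m y + 3 * Z.of_nat u)%Z.
Proof.
  intros Hm Hz H. apply repZ_app_inv in H. destruct H as (w & (x & y & Hw) & H).
  simpl in Hw.
  pose proof (Pm_nonneg m x ltac:(lia)). pose proof (Pm_nonneg m y ltac:(lia)).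
  apply repZ_repeat_small in H; [|lia..]. destruct H as (u & Hu & H).
  exists x, y, u. split; auto. lia.
Qed.

(* The residue classes modulo 3 of the values built from one or two large [Pm]'s
   avoid that of 3m-10 or 3m-12, so this number needs a sum of coefficients. *)
Lemma one_one_threes_not_universal (m k : nat) : 20 <= m -> m mod 3 <> 2 -> k + 5 <= m ->
  ~ universal m ([1; 1] ++ repeat 3 k).
Proof.
  intros Hm Hm3 Hk H.
  pose proof (Nat.div_mod_eq m 3) as Em. pose proof (Nat.mod_upper_bound m 3 ltac:(lia)).
  assert (E : m mod 3 = 0 \/ m mod 3 = 1) by lia.
  specialize (H (if m mod 3 =? 0 then 3 * m - 10 else 3 * m - 12)).
  apply represents_repZ in H; [|destruct (m mod 3 =? 0); lia].
  destruct (Nat.eqb_spec (m mod 3) 0);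
    (apply pair_threes_inv in H; [|lia..]; destruct H as (x & y & u & Hu & H);
     pose proof (Pm_values m x ltac:(lia)); pose proof (Pm_values m y ltac:(lia)); lia).
Qed.

Lemma one_two_threes_not_universal (m k : nat) : 20 <= m -> m mod 3 = 2 -> k + 6 <= m ->
  ~ universal m ([1; 2] ++ repeat 3 k).
Proof.
  intros Hm Hm3 Hk H.
  pose proof (Nat.div_mod_eq m 3) as Em.
  specialize (H (3 * m - 12) ltac:(lia)). apply represents_repZ in H.
  apply pair_threes_inv in H; [|lia..]. destruct H as (x & y & u & Hu & H).
  pose proof (Pm_values m x ltac:(lia)). pose proof (Pm_values m y ltac:(lia)). lia.
Qed.

Lemma standing_truant_bound (C : R) (m t : nat) (a : list nat) : standing_assumption C ->
  3 <= m -> escalator_node m a -> truant m a t -> (INR t <= C * (INR m - 2))%R.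
Proof.
  intros HC Hm Ha Ht. apply Rnot_lt_le; intros Hlt.
  apply (truant_not_universal m a t Ht), (HC m Hm a); [now apply (node_valid m)|].
  intros N HN HNC. destruct Ht as (_ & _ & Ht). apply Ht. split; auto.
  apply INR_lt. lra.
Qed.

Lemma standing_ge_3 (C : R) : standing_assumption C -> (3 <= C)%R.
Proof.
  intros HC. apply Rnot_lt_le; intros Hlt.
  destruct (INR_unbounded (6 / (3 - C))) as (n & Hn).
  set (m := 3 * (n + 20)).
  assert (Hm3 : m mod 3 <> 2) by (unfold m; rewrite Nat.mul_comm, Nat.Div0.mod_mul; lia).
  assert (Ha : escalator_node m ([1; 1] ++ repeat 3 (m - 5))).
  { apply node_threes; try lia. intros j Hj. apply one_one_threes_not_universal; auto; lia. }
  destruct (truant_exists m ([1; 1] ++ repeat 3 (m - 5))) as (t & Ht).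
  { apply one_one_threes_not_universal; auto; lia. }
  pose proof (standing_truant_bound C m t _ HC ltac:(lia) Ha Ht) as H1.
  pose proof (truant_gt_sum m _ t ltac:(lia) Ha Ht) as H2.
  rewrite zsum_app, zsum_repeat in H2. unfold zsum in H2. simpl list_sum in H2.
  assert (H3 : 3 * m <= t + 12) by lia.
  apply le_INR in H3. rewrite mult_INR, plus_INR in H3.
  assert (Hm : (INR m = 3 * (INR n + 20))%R).
  { unfold m. rewrite mult_INR, plus_INR. simpl. lra. }
  simpl in H3. pose proof (pos_INR n).
  assert (H4 : (6 < INR n * (3 - C))%R).
  { apply (Rmult_lt_compat_r (3 - C)) in Hn; [|lra].
    unfold Rdiv in Hn. rewrite Rmult_assoc, Rinv_l in Hn by lra. lra. }
  nra.
Qed.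

Lemma nat_bound (C : R) (m : nat) : (3 <= C)%R -> (INR m > 6 * C ^ 2 * (C + 1))%R ->
  exists K, 4 <= K /\ 3 * (K * K * K) + 20 <= m /\ (C <= INR K)%R.
Proof.
  intros HC Hm. destruct (archimed C) as (H1 & H2).
  assert (H3 : (3 < up C)%Z) by (apply lt_IZR; simpl; lra).
  set (K := Z.to_nat (up C)).
  assert (EK : INR K = IZR (up C)) by (unfold K; rewrite INR_IZR_INZ, Z2Nat.id by lia; reflexivity).
  assert (HK : 4 <= K) by (unfold K; lia).
  exists K. repeat split; auto; [|lra].
  assert (H4 : (INR (6 * ((K - 1) * (K - 1)) * K) < INR m)%R).
  { rewrite !mult_INR, minus_INR by lia. rewrite EK.
    replace (INR 6) with 6%R by (simpl; lra). change (INR 1) with 1%R.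
    assert (H5 : (0 <= IZR (up C) - 1 <= C)%R) by lra.
    assert ((IZR (up C) - 1) * (IZR (up C) - 1) <= C * C)%R by nra.
    assert (0 <= (IZR (up C) - 1) * (IZR (up C) - 1))%R by nra.
    assert ((IZR (up C) - 1) * (IZR (up C) - 1) * IZR (up C) <= C * C * (C + 1))%R
      by (apply Rmult_le_compat; lra).
    simpl in Hm. lra. }
  apply INR_lt in H4. nia.
Qed.

(* R_m (maximal rank of a leaf) equals the stated value: some leaf has that
   rank and every leaf has rank at most that. *)
Theorem theorem2p3 :
  forall C : R, standing_assumption C ->
  forall m : nat, 3 <= m -> (INR m > 6 * C ^ 2 * (C + 1))%R ->
    let r := if Nat.eqb (m mod 3) 2 then m - 3 else m - 2 in
    (exists a, escalator_leaf m a /\ length a = r) /\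
    (forall a, escalator_leaf m a -> length a <= r).
Proof.
  intros C HC m Hm HmC r.
  pose proof (standing_ge_3 C HC) as HC3.
  destruct (nat_bound C m HC3 HmC) as (K & HK & HmK & HCK).
  assert (HmK' : 20 <= m) by lia.
  assert (Hlen : forall b, escalator_node m b -> ~ universal m b -> length b + 1 <= r).
  { intros b Hb Hu. destruct (truant_exists m b Hu) as (t & Ht).
    assert (HtK : t <= K * (m - 2)).
    { apply INR_le. rewrite mult_INR, minus_INR by lia. change (INR 2) with 2%R.
      pose proof (standing_truant_bound C m t b HC Hm Hb Ht).
      assert (2 <= INR m)%R by (apply (le_INR 2); lia). nra. }
    pose proof (nonuniversal_length m K t b ltac:(lia) HmK Hb Ht HtK) as H.
    unfold r. destruct (m mod 3 =? 2); lia. }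
  split.
  - assert (H : exists a, escalator_node m a /\ length a = r).
    { unfold r. destruct (Nat.eqb_spec (m mod 3) 2) as [E|E].
      - exists ([1; 2] ++ repeat 3 (m - 5)). split; [|simpl; rewrite repeat_length; lia].
        apply node_threes; try lia. intros j Hj.
        apply one_two_threes_not_universal; auto; lia.
      - exists ([1; 1] ++ repeat 3 (m - 4)). split; [|simpl; rewrite repeat_length; lia].
        apply node_threes; try lia. intros j Hj.
        apply one_one_threes_not_universal; auto; lia. }
    destruct H as (a & Ha & Hr). exists a. repeat split; auto.
    apply NNPP. intros Hu. specialize (Hlen a Ha Hu). lia.
  - intros a (Ha & Hu). inversion Ha as [E|b t c Hb Ht Hc Hr E]; subst.
    + simpl. lia.
    + rewrite length_app. apply Hlen; auto. now apply (truant_not_universal m b t).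
Qed.
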